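(* Consider the recursive equation $$R(X,n)=\min\bigl(R_1(X,n),R_2(X,n)\bigr),$$ where $n$ is a nonnegative multiple of $M$ with $n\le N$, $R_1(X,n)=R_2(X,n)=0$ for $n=N$, and, for $n<N$, $$R_1(X,n)=(N-n)\,g_1(X,n),\qquad R_2(X,n)=M g_2(X,n)+R(X,n+M)*f_{MD}(X),$$ with $$g_1(X,n)=\int_0^C m\exp\left(D^{-1}(Xm-0.5\,nm^2)\right)\lambda(m)\,dm,$$ $$g_2(X,n)=\int_{-C}^0|m|\exp\left(D^{-1}(Xm-0.5\,nm^2)\right)\lambda(m)\,dm.$$ Then the solution gives the Bayesian risk and a Bayesian strategy (over strategies that process the data in batches of size $M$): $R(X,n)=R(0,X,n)$, where $R(k,X,n)$ is the risk function defined in the context; in particular $R^B_N(\lambda)=R(0,0)$. The strategy which, as long as only the second action has been used, with statistics $(X,n)$, chooses the action $\ell$ with the smaller value of $R_\ell(X,n)$ (arbitrarily in case of equality), and which applies the first action, once it has been chosen, until the end of the control, is a Bayesian strategy.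
   Context: Gaussian densities: for a variance $V>0$, $f_V(x|a)=(2\pi V)^{-1/2}\exp\{-(x-a)^2/(2V)\}$ and $f_V(x)=f_V(x|0)$. Convolution is taken in the $X$ variable: $F(x)*G(x)=\int_{-\infty}^{\infty}F(x-y)G(y)\,dy$. Gaussian one-armed bandit: fix $D>0$, $0<C<\infty$ and positive integers $N,M$ with $N$ a multiple of $M$. At each step $i=1,\dots,N$ an action $y_i\in\{1,2\}$ is chosen and a random income $\xi_i$ depending only on the current action is received. If $y_i=2$, $\xi_i$ has density $f_D(x|m)$ with $D$ known and $m$ unknown; if $y_i=1$, $\xi_i$ has a known distribution with expectation $0$. The parameter is $\theta=(0,m)$, with $\Theta=\{\theta=(0,m):|m|\le C\}$. Strategies: the history is described by $(k,X,n)$, where $k,n$ are the numbers of past applications of the first and the second action and $X$ is the cumulative income from the second action ($X=0$ if $n=0$). A strategy $\sigma$ assigns to each history a (possibly randomized) selection of the next action, and only strategies that may change the action after applying it $M$ times in succession are used: a selection is made when $k,n$ are multiples of $M$ and the selected action is used for the next $M$ steps. Loss: $L_N(\sigma,\theta)=N\max(0,m)-\mathrm{E}_{\sigma,\theta}\bigl(\sum_{i=1}^N\xi_i\bigr)$. Prior: $\lambda$ is a probability density of $m$ on $[-C,C]$ with $\int_{-C}^0|m|\lambda(m)\,dm>0$ and $\int_0^C m\lambda(m)\,dm>0$. Bayesian risk: $R^B_N(\lambda)=\min_{\sigma}\int_{-C}^{C}L_N(\sigma,(0,m))\,\lambda(m)\,dm$; a strategy attaining the minimum is called a Bayesian strategy.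 Risk function $R(k,X,n)$: for $k,n$ nonnegative multiples of $M$ with $k+n\le N$, $R(k,X,n)=\min(R_1(k,X,n),R_2(k,X,n))$, where $R_1(k,X,n)=R_2(k,X,n)=0$ if $k+n=N$, and otherwise $R_1(k,X,n)=Mg_1(X,n)+R(k+M,X,n)$, $R_2(k,X,n)=Mg_2(X,n)+R(k,X,n+M)*f_{MD}(X)$, with $g_1,g_2$ as in the claim. *)

(* Defs.v *)
From HB Require Import structures.
From mathcomp Require Import all_boot all_order all_algebra.
From mathcomp Require Import all_classical all_reals all_analysis.

Set Implicit Arguments.
Unset Strict Implicit.
Unset Printing Implicit Defensive.

Import Order.TTheory GRing.Theory Num.Theory.
Import numFieldNormedType.Exports.

Local Open Scope classical_set_scope.
Local Open Scope ring_scope.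

(* f_V(x|a): the second parameter of normal_pdf is the standard deviation. *)
Definition gauss_pdf (R : realType) (V a x : R) : R :=
  normal_pdf a (Num.sqrt V) x.

Lemma gauss_pdfE (R : realType) (V a x : R) : 0 < V ->
  gauss_pdf V a x =
  (Num.sqrt (2 * pi * V))^-1 * expR (- (x - a) ^+ 2 / (2 * V)).
Proof.
move=> V0; rewrite /gauss_pdf normal_pdfE ?gt_eqF ?sqrtr_gt0//.
rewrite /normal_peak /normal_fun sqr_sqrtr ?ltW//.
by rewrite -[V * pi *+ 2]mulr_natl -[V *+ 2]mulr_natl [V * pi]mulrC mulrA.
Qed.

Definition conv (R : realType) (F G : R -> R) (x : R) : R :=
  \int[lebesgue_measure]_y (F (x - y) * G y).

Inductive arm := Arm1 | Arm2.

Definition is_arm1 (a : arm) : bool := if a is Arm1 then true else false.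

Definition is_arm2 (a : arm) : bool := ~~ is_arm1 a.

(* The pairs (y_i, xi_i) of the past steps, the most recent one first. *)
Definition history (R : realType) := seq (arm * R).

Section Histories.
Context {R : realType}.
Implicit Type h : history R.

Definition count1 h : nat := count (fun s => is_arm1 s.1) h.

Definition count2 h : nat := count (fun s => is_arm2 s.1) h.

Definition income2 h : R := \sum_(s <- h | is_arm2 s.1) s.2.

Definition total_income h : R := \sum_(s <- h) s.2.

End Histories.

(* sigma k X n is the probability of selecting the first action; its values are
   only used when k and n are multiples of the batch size (see prob_arm1). *)
Record strategy (R : realType) := Strategy {
  select1 :> nat -> R -> nat -> R;
  select1_prob : forall k X n, 0 <= select1 k X n <= 1;
  select1_meas : forall k n, measurable_fun setT (fun X => select1 k X n) }.

Section Bandit.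
Context {R : realType}.
(* N: horizon; M: batch size; C: bound on |m|; D: variance of the second
   action; nu: income law of the first action; lam: prior density of m. *)
Context (N M : nat) (C D : R) (nu : probability R R) (lam : R -> R).

(* Inside a batch the last action is repeated. *)
Definition prob_arm1 (sigma : strategy R) (h : history R) : R :=
  if (M %| count1 h)%N && (M %| count2 h)%N
  then sigma (count1 h) (income2 h) (count2 h)
  else if h is s :: _ then (is_arm1 s.1)%:R else 0.

(* Expectation of a function F of the whole history when t steps remain after
   the history h: integration against the successive transition kernels, which
   draw the next action given the past, then its income. *)
Fixpoint expect (sigma : strategy R) (m : R) (F : history R -> R) (t : nat)
    (h : history R) : R :=
  if t is t'.+1 then
    prob_arm1 sigma h *
      (\int[nu]_x expect sigma m F t' ((Arm1, x) :: h)) +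
    (1 - prob_arm1 sigma h) *
      (\int[normal_prob m (Num.sqrt D)]_x
         expect sigma m F t' ((Arm2, x) :: h))
  else F h.

Definition loss (sigma : strategy R) (m : R) : R :=
  N%:R * Num.max 0 m - expect sigma m total_income N [::].

Definition integrated_loss (sigma : strategy R) : R :=
  \int[lebesgue_measure]_(m in `[- C, C]) (loss sigma m * lam m).

Definition bayes_risk : R := inf (range integrated_loss).

Definition bayesian (sigma : strategy R) : Prop :=
  forall tau : strategy R, integrated_loss sigma <= integrated_loss tau.

Definition g1 (X : R) (n : nat) : R :=
  \int[lebesgue_measure]_(m in `[0, C])
    (m * expR (D^-1 * (X * m - 2^-1 * n%:R * m ^+ 2)) * lam m).

Definition g2 (X : R) (n : nat) : R :=
  \int[lebesgue_measure]_(m in `[- C, 0])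
    (`|m| * expR (D^-1 * (X * m - 2^-1 * n%:R * m ^+ 2)) * lam m).

Local Notation fMD := (gauss_pdf (M%:R * D) 0).

(* R(X,n) with b batches remaining; the recursion itself is risk_eq below. *)
Fixpoint risk_rec (b : nat) (X : R) (n : nat) : R :=
  if b is b'.+1 then
    Num.min ((N - n)%:R * g1 X n)
            (M%:R * g2 X n + conv (fun x => risk_rec b' x (n + M)) fMD X)
  else 0.

Definition risk (X : R) (n : nat) : R := risk_rec ((N - n) %/ M) X n.

Definition risk1 (X : R) (n : nat) : R :=
  if (n < N)%N then (N - n)%:R * g1 X n else 0.

Definition risk2 (X : R) (n : nat) : R :=
  if (n < N)%N then M%:R * g2 X n + conv (fun x => risk x (n + M)) fMD X
  else 0.

(* R(k,X,n) with b batches remaining; the recursion itself is full_risk_eq. *)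
Fixpoint full_risk_rec (b k : nat) (X : R) (n : nat) : R :=
  if b is b'.+1 then
    Num.min (M%:R * g1 X n + full_risk_rec b' (k + M) X n)
            (M%:R * g2 X n + conv (fun x => full_risk_rec b' k x (n + M)) fMD X)
  else 0.

Definition full_risk (k : nat) (X : R) (n : nat) : R :=
  full_risk_rec ((N - (k + n)) %/ M) k X n.

Definition full_risk1 (k : nat) (X : R) (n : nat) : R :=
  if (k + n < N)%N then M%:R * g1 X n + full_risk (k + M) X n else 0.

Definition full_risk2 (k : nat) (X : R) (n : nat) : R :=
  if (k + n < N)%N
  then M%:R * g2 X n + conv (fun x => full_risk k x (n + M)) fMD X
  else 0.

Lemma batches_left (n : nat) : (0 < M)%N -> (M %| N)%N -> (M %| n)%N ->
  (n < N)%N -> ((N - n) %/ M = ((N - (n + M)) %/ M).+1)%N.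
Proof.
move=> M0 MN Mn nN; have MNn : (M %| N - n)%N by rewrite dvdn_sub.
have leM : (M <= N - n)%N by rewrite dvdn_leq// subn_gt0.
by rewrite subnDA -{1}(subnK leM) divnDr// divnn M0 addn1.
Qed.

Lemma risk_eq (X : R) (n : nat) : (0 < M)%N -> (M %| N)%N -> (M %| n)%N ->
  (n <= N)%N -> risk X n = Num.min (risk1 X n) (risk2 X n).
Proof.
move=> M0 MN Mn; rewrite leq_eqVlt /risk1 /risk2 => /orP[/eqP ->|nN].
  by rewrite ltnn minxx /risk subnn div0n.
by rewrite nN /risk batches_left.
Qed.

Lemma full_risk_eq (k : nat) (X : R) (n : nat) : (0 < M)%N -> (M %| N)%N ->
  (M %| k)%N -> (M %| n)%N -> (k + n <= N)%N ->
  full_risk k X n = Num.min (full_risk1 k X n) (full_risk2 k X n).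
Proof.
move=> M0 MN Mk Mn; rewrite leq_eqVlt /full_risk1 /full_risk2.
move=> /orP[/eqP knN|knN].
  by rewrite knN ltnn minxx /full_risk knN subnn div0n.
rewrite knN /full_risk batches_left ?dvdn_add//=.
by rewrite addnA (addnAC k M n).
Qed.

(* The hypothesis n = 0 -> X = 0 says that (k,X,n) is a history; in case of
   equality of risk1 and risk2 the selection is unconstrained. *)
Definition one_armed_rule (sigma : strategy R) : Prop :=
  (forall (X : R) (n : nat), (M %| n)%N -> (n < N)%N -> (n = 0%N -> X = 0) ->
     (risk1 X n < risk2 X n -> sigma 0%N X n = 1) /\
     (risk2 X n < risk1 X n -> sigma 0%N X n = 0)) /\
  (forall (k : nat) (X : R) (n : nat), (0 < k)%N -> (M %| k)%N -> (M %| n)%N ->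
     (k + n < N)%N -> (n = 0%N -> X = 0) -> sigma k X n = 1).

End Bandit.

(* Main.v *)
(** Write the regret of a strategy as a nonnegative function of the statistics
    [(k, X, n)] and integrate it against the unnormalised posterior density
    [lam m * exp((X m - n m^2 / 2) / D)].  The likelihood ratio of [N(m, D)] to
    [N(0, D)] turns a step with the second arm into a Gaussian smoothing of the
    posterior regret, and [M] such smoothings compose to the convolution with
    [f_{MD}]; hence the posterior regret of every strategy obeys an exact
    recursion over batches, whose minimum is the risk function.  That switching
    to the first arm can be taken as final rests on the identity
    [g1(., n + M) * f_{MD} = g1(., n)]: a batch of the first arm played before a
    batch of the second one can be postponed at no cost, so postponing all of
    them to the end is optimal. *)
Require Import Defs.
From HB Require Import structures.
From mathcomp Require Import all_boot all_order all_algebra.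
From mathcomp Require Import all_classical all_reals all_analysis.
From mathcomp Require Import measurable_realfun ring lra.
Import Order.TTheory GRing.Theory Num.Theory.
Import numFieldNormedType.Exports.
Local Open Scope classical_set_scope.
Local Open Scope ring_scope.

Set Implicit Arguments.
Unset Strict Implicit.
Unset Printing Implicit Defensive.

(** * Lebesgue measure and densities *)

Section LebesgueInvariance.
Context {R : realType}.
Local Notation mu := (@lebesgue_measure R).
Local Open Scope ereal_scope.

(** A measure agreeing with Lebesgue measure on half-open intervals is Lebesgue measure, so the
    pushforward along [phi] is [mu]. Translations and the reflection are the instances needed. *)
Lemma ge0_integral_comp_preserving (phi : R -> R) (f : R -> \bar R) :
  measurable_fun setT phi ->
  (forall b c : R, mu (phi @^-1` `]b, c]) = mu `]b, c]) ->
  measurable_fun setT f -> (forall x, 0 <= f x) ->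
  \int[mu]_x f (phi x) = \int[mu]_x f x.
Proof.
move=> mphi phiE mf f0.
pose phiB := isMeasurableFun.Build _ _ (measurableTypeR R) (measurableTypeR R) phi mphi.
pose phiM : {mfun (measurableTypeR R) >-> (measurableTypeR R)} := HB.pack phi phiB.
rewrite -[setT in LHS](preimage_setT phi).
rewrite -(@ge0_integral_pushforward _ _ (measurableTypeR R) (measurableTypeR R)
  _ phi mphi mu _ f)//.
apply: eq_measure_integral => //= A mA _.
apply/esym; apply: (lebesgue_measure_unique (mu := pushforward mu phiM)) => //=.
by move=> _ [[b c]] _ <-; rewrite /pushforward phiE.
Qed.

Lemma ge0_integral_shift (a : R) (f : R -> \bar R) :
  measurable_fun setT f -> (forall x, 0 <= f x) ->
  \int[mu]_x f (x + a)%R = \int[mu]_x f x.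
Proof.
apply: (ge0_integral_comp_preserving (phi := fun x => (x + a)%R)) => [|b c].
  exact: measurable_funD.
have -> : (fun x : R => (x + a)%R) @^-1` `]b, c] = `](b - a)%R, (c - a)%R]%classic.
  by apply/seteqP; split => x /=; rewrite !in_itv/= ltrBlDr lerBrDr.
by rewrite !lebesgue_measure_itv/= !lte_fin ltrD2r -!EFinB opprB addrA subrK.
Qed.

Lemma ge0_integral_oppr (f : R -> \bar R) :
  measurable_fun setT f -> (forall x, 0 <= f x) ->
  \int[mu]_x f (- x)%R = \int[mu]_x f x.
Proof.
apply: (ge0_integral_comp_preserving (phi := -%R)) => [|b c].
  exact: measurable_funN.
exact: lebesgue_measureN.
Qed.

(** The Radon-Nikodym derivative of the normal law and [normal_pdf] have the same integral over
    every measurable set, hence agree almost everywhere. *)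
Lemma ge0_integral_normal_prob (m s : R) (f : R -> \bar R) :
  measurable_fun setT f -> (forall x, 0 <= f x) ->
  \int[normal_prob m s]_x f x = \int[mu]_x (f x * (normal_pdf m s x)%:E).
Proof.
move=> mf f0.
have mp : measurable_fun setT (fun x => (normal_pdf m s x)%:E).
  by apply/measurable_EFinP; exact: measurable_normal_pdf.
have dom := @normal_prob_dominates R m s.
rewrite -(Radon_Nikodym_SigmaFinite.change_of_variables dom)//.
have iRN := Radon_Nikodym_SigmaFinite.f_integrable dom.
apply: ae_eq_integral => //.
- by apply: emeasurable_funM => //; exact: (measurable_int mu).
- exact: emeasurable_funM.
- apply: ae_eqe_mul2l => /=; apply: integral_ae_eq => //= E _ mE.
  by rewrite -Radon_Nikodym_SigmaFinite.f_integral.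
Qed.

End LebesgueInvariance.

(** * Gaussian smoothing *)

Section Gauss.
Context {R : realType}.
Local Notation mu := (@lebesgue_measure R).
Implicit Types V W D a m x y z : R.

Lemma gauss_pdf_ge0 V a x : 0 <= gauss_pdf V a x.
Proof. exact: normal_pdf_ge0. Qed.

Lemma measurable_gauss_pdf V a : measurable_fun setT (gauss_pdf V a).
Proof. exact: measurable_normal_pdf. Qed.

Lemma integral_gauss_pdf V a : (\int[mu]_x (gauss_pdf V a x)%:E = 1)%E.
Proof. exact: integral_normal_pdf. Qed.

Lemma gauss_pdf_center V a x : 0 < V -> gauss_pdf V a x = gauss_pdf V 0 (x - a).
Proof. by move=> V0; rewrite !gauss_pdfE// subr0. Qed.

Lemma gauss_pdfN V x : 0 < V -> gauss_pdf V 0 (- x) = gauss_pdf V 0 x.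
Proof. by move=> V0; rewrite !gauss_pdfE// !subr0 sqrrN. Qed.

Lemma gauss_pdf_tilt D m x : 0 < D ->
  gauss_pdf D m x = gauss_pdf D 0 x * expR (D^-1 * (x * m - 2^-1 * m ^+ 2)).
Proof.
move=> D0; rewrite !gauss_pdfE// -[RHS]mulrA -expRD; congr (_ * expR _).
by field; rewrite gt_eqF.
Qed.

(** Completing the square in [y]: the second factor on the right is a probability density in [y], so
    integrating over [y] leaves the density of the sum. *)
Lemma gauss_pdfM V W z y : 0 < V -> 0 < W ->
  gauss_pdf V 0 (z - y) * gauss_pdf W 0 y =
  gauss_pdf (V + W) 0 z * gauss_pdf (V * W / (V + W)) (z * W / (V + W)) y.
Proof.
move=> V0 W0; have VW0 : 0 < V + W by rewrite addr_gt0.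
have U0 : 0 < V * W / (V + W) by rewrite divr_gt0// mulr_gt0.
have pi2 : 0 <= 2 * pi :> R by rewrite mulr_ge0// pi_ge0.
rewrite !gauss_pdfE// mulrACA [RHS]mulrACA -!expRD; congr (_ * expR _).
  rewrite -!invfM -!sqrtrM ?mulr_ge0 ?pi_ge0 ?ltW//; congr (Num.sqrt _)^-1.
  by field; rewrite gt_eqF.
by field; rewrite !gt_eqF.
Qed.

Lemma gauss_pdf_conv V W z : 0 < V -> 0 < W ->
  (\int[mu]_y ((gauss_pdf V 0 (z - y)%R)%:E * (gauss_pdf W 0 y)%:E) =
   (gauss_pdf (V + W) 0 z)%:E)%E.
Proof.
move=> V0 W0; under eq_integral do rewrite -EFinM gauss_pdfM// EFinM.
rewrite ge0_integralZl//=.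
- by rewrite integral_gauss_pdf mule1.
- by apply/measurable_EFinP; exact: measurable_gauss_pdf.
- by move=> y _; rewrite lee_fin gauss_pdf_ge0.
- by rewrite lee_fin gauss_pdf_ge0.
Qed.

(** Extended values let Tonelli apply to nonnegative functions without finiteness conditions. The
    argument [X + x] reads as adding an income; by symmetry of the density this is the
    convolution. *)
Definition gauss_smooth V (u : R -> \bar R) (X : R) : \bar R :=
  (\int[mu]_x (u (X + x)%R * (gauss_pdf V 0 x)%:E))%E.

Lemma gauss_smooth_ge0 V u X : (forall x, 0 <= u x)%E ->
  (0 <= gauss_smooth V u X)%E.
Proof.
by move=> u0; apply: integral_ge0 => x _; rewrite mule_ge0// lee_fin gauss_pdf_ge0.
Qed.

Lemma measurable_gauss_smooth V u : measurable_fun setT u ->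
  (forall x, 0 <= u x)%E -> measurable_fun setT (gauss_smooth V u).
Proof.
move=> mu_ u0; apply: (measurable_fun_fubini_tonelli_F (m2 := mu)
  (fun p : R * R => (u (p.1 + p.2)%R * (gauss_pdf V 0 p.2)%:E)%E)).
- apply: emeasurable_funM.
    by apply: (measurableT_comp mu_); exact: measurable_funD.
  by apply/measurable_EFinP/(measurableT_comp (measurable_gauss_pdf V 0)).
- by move=> p; rewrite mule_ge0// lee_fin gauss_pdf_ge0.
Qed.

Let measurable_smooth_integrand V u X : measurable_fun setT u ->
  measurable_fun setT (fun x => (u (X + x)%R * (gauss_pdf V 0 x)%:E)%E).
Proof.
move=> mu_; apply: emeasurable_funM.
  by apply: (measurableT_comp mu_); exact: measurable_funD.
by apply/measurable_EFinP; exact: measurable_gauss_pdf.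
Qed.

Let smooth_integrand_ge0 V u X x : (forall x, 0 <= u x)%E ->
  (0 <= u (X + x)%R * (gauss_pdf V 0 x)%:E)%E.
Proof. by move=> u0; rewrite mule_ge0// lee_fin gauss_pdf_ge0. Qed.

Lemma gauss_smoothD V u v X : measurable_fun setT u -> measurable_fun setT v ->
  (forall x, 0 <= u x)%E -> (forall x, 0 <= v x)%E ->
  gauss_smooth V (fun x => u x + v x)%E X =
  (gauss_smooth V u X + gauss_smooth V v X)%E.
Proof.
move=> mu_ mv u0 v0; rewrite -ge0_integralD//; last 4 first.
- by move=> x _; exact: smooth_integrand_ge0.
- exact: measurable_smooth_integrand.
- by move=> x _; exact: smooth_integrand_ge0.
- exact: measurable_smooth_integrand.
by apply: eq_integral => x _; rewrite ge0_muleDl.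
Qed.

Lemma gauss_smoothZ V u X (c : R) : measurable_fun setT u ->
  (forall x, 0 <= u x)%E -> 0 <= c ->
  gauss_smooth V (fun x => c%:E * u x)%E X = (c%:E * gauss_smooth V u X)%E.
Proof.
move=> mu_ u0 c0; rewrite -ge0_integralZl//.
- by apply: eq_integral => x _; rewrite muleA.
- exact: measurable_smooth_integrand.
- by move=> x _; exact: smooth_integrand_ge0.
Qed.

Lemma le_gauss_smooth V u v X : measurable_fun setT u -> measurable_fun setT v ->
  (forall x, 0 <= u x)%E -> (forall x, u x <= v x)%E ->
  (gauss_smooth V u X <= gauss_smooth V v X)%E.
Proof.
move=> mu_ mv u0 uv; apply: ge0_le_integral => //.
- by move=> x _; exact: smooth_integrand_ge0.
- exact: measurable_smooth_integrand.
- exact: measurable_smooth_integrand.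
- by move=> x _; rewrite lee_wpmul2r// lee_fin gauss_pdf_ge0.
Qed.

(** The semigroup property, obtained from Tonelli and the convolution of two Gaussian densities. *)
Lemma gauss_smooth_smooth V W u X : 0 < V -> 0 < W -> measurable_fun setT u ->
  (forall x, 0 <= u x)%E ->
  gauss_smooth V (gauss_smooth W u) X = gauss_smooth (V + W) u X.
Proof.
move=> V0 W0 mu_ u0.
(* The second coordinate is the total displacement, so that [u] does not depend on the first one and
   comes out of the inner integral after the swap. *)
pose f (p : R * R) :=
  (u (X + p.2)%R * (gauss_pdf W 0 (p.2 - p.1)%R)%:E * (gauss_pdf V 0 p.1)%:E)%E.
have mf : measurable_fun setT f.
  apply: emeasurable_funM; first apply: emeasurable_funM.
  - by apply: (measurableT_comp mu_); exact: measurable_funD.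
  - apply/measurable_EFinP/(measurableT_comp (measurable_gauss_pdf W 0)).
    exact: measurable_funB.
  - by apply/measurable_EFinP/(measurableT_comp (measurable_gauss_pdf V 0)).
have f0 p : (0 <= f p)%E by rewrite /f !mule_ge0// lee_fin gauss_pdf_ge0.
transitivity (\int[mu]_x \int[mu]_y f (x, y))%E.
  apply: eq_integral => x _.
  rewrite {1}/gauss_smooth -ge0_integralZr; last 4 first.
  - exact: measurableT.
  - exact: measurable_smooth_integrand.
  - by move=> y _; exact: smooth_integrand_ge0.
  - by rewrite lee_fin gauss_pdf_ge0.
  rewrite -[RHS](ge0_integral_shift x).
  - by apply: eq_integral => y _; rewrite /f/= addrK (addrC y) addrA.
  - by apply: (measurableT_comp mf); exact: measurable_fun_pair.
  - by move=> y; exact: f0.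
rewrite fubini_tonelli; [|exact: mf|exact: f0].
apply: eq_integral => y _; rewrite /f/=.
under eq_integral do rewrite -muleA.
rewrite ge0_integralZl; last 4 first.
- exact: measurableT.
- apply: emeasurable_funM; apply/measurable_EFinP; last exact: measurable_gauss_pdf.
  by apply: (measurableT_comp (measurable_gauss_pdf W 0)); exact: measurable_funB.
- by move=> x _; rewrite mule_ge0// lee_fin gauss_pdf_ge0.
- exact: u0.
by rewrite (gauss_pdf_conv _ W0 V0) [(W + V)%R]addrC.
Qed.

(** The count starts at one: zero iterations give the identity, which is not smoothing by a
    density. *)
Lemma iter_gauss_smooth D u j X : 0 < D -> measurable_fun setT u ->
  (forall x, 0 <= u x)%E ->
  iter j.+1 (gauss_smooth D) u X = gauss_smooth (j.+1%:R * D) u X.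
Proof.
move=> D0 mu_ u0; elim: j X => [|j IH] X; first by rewrite mul1r.
rewrite iterS; have -> : iter j.+1 (gauss_smooth D) u = gauss_smooth (j.+1%:R * D) u.
  by apply/funext.
rewrite (gauss_smooth_smooth _ D0 _ mu_ u0); last by rewrite mulr_gt0.
by congr (gauss_smooth _ u X); rewrite -[j.+2%:R]natr1 mulrDl mul1r addrC.
Qed.

Lemma integral_conv (u : R -> R) V X : 0 < V -> measurable_fun setT u ->
  (forall x, 0 <= u x) ->
  (\int[mu]_y (u (X - y) * gauss_pdf V 0 y)%:E)%E = gauss_smooth V (EFin \o u) X.
Proof.
move=> V0 mu_ u0; rewrite -[LHS]ge0_integral_oppr.
- by apply: eq_integral => y _; rewrite opprK gauss_pdfN// EFinM.
- apply/measurable_EFinP/measurable_funM; last exact: measurable_gauss_pdf.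
  by apply: (measurableT_comp mu_); exact: measurable_funB.
- by move=> y; rewrite lee_fin mulr_ge0// gauss_pdf_ge0.
Qed.

End Gauss.

(** * Expectations under the normal law *)

Section NormalExpectation.
Context {R : realType} (D : R) (D0 : 0 < D).
Local Notation mu := (@lebesgue_measure R).
Local Notation gauss m := (normal_prob m (Num.sqrt D)).

Lemma ge0_integral_gauss_center (m : R) (g : R -> \bar R) :
  measurable_fun setT g -> (forall x, 0 <= g x)%E ->
  (\int[gauss m]_x g (x - m)%R = \int[mu]_y (g y * (gauss_pdf D 0 y)%:E))%E.
Proof.
move=> mg g0.
rewrite ge0_integral_normal_prob; last 2 first.
- by apply: (measurableT_comp mg); exact: measurable_funB.
- by move=> x; exact: g0.
rewrite -[RHS](ge0_integral_shift (- m)).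
- apply: eq_integral => x _; congr (_ * _%:E)%E; exact: gauss_pdf_center.
- by apply: emeasurable_funM => //; apply/measurable_EFinP; exact: measurable_gauss_pdf.
- by move=> x; rewrite mule_ge0// lee_fin gauss_pdf_ge0.
Qed.

(** Up to the factor [expR (D / 2)], the exponential is the likelihood ratio of mean [D] to mean
    [0], so the integrand is a multiple of a shifted density. *)
Let gauss_expR :
  (\int[mu]_y ((expR y)%:E * (gauss_pdf D 0 y)%:E) = (expR (D / 2))%:E)%E.
Proof.
transitivity (\int[mu]_y ((expR (D / 2))%:E * (gauss_pdf D D y)%:E))%E.
  apply: eq_integral => y _; rewrite -!EFinM; congr (_%:E).
  rewrite (gauss_pdf_tilt D y D0) mulrCA -expRD mulrC; congr (_ * expR _).
  by field; rewrite gt_eqF.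
rewrite ge0_integralZl; last 4 first.
- exact: measurableT.
- by apply/measurable_EFinP; exact: measurable_gauss_pdf.
- by move=> y _; rewrite lee_fin gauss_pdf_ge0.
- by rewrite lee_fin expR_ge0.
by rewrite integral_gauss_pdf mule1.
Qed.

Let gauss_integralN (g : R -> \bar R) :
  measurable_fun setT g -> (forall x, 0 <= g x)%E ->
  (\int[mu]_y (g (- y)%R * (gauss_pdf D 0 y)%:E) =
   \int[mu]_y (g y * (gauss_pdf D 0 y)%:E))%E.
Proof.
move=> mg g0; rewrite -[RHS]ge0_integral_oppr.
- by apply: eq_integral => y _; rewrite gauss_pdfN.
- by apply: emeasurable_funM => //; apply/measurable_EFinP; exact: measurable_gauss_pdf.
- by move=> x; rewrite mule_ge0// lee_fin gauss_pdf_ge0.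
Qed.

(** The absolute value of [y] is dominated by [expR y + expR (- y)], and both exponentials have the
    same finite Gaussian integral. *)
Lemma integrable_gauss_centered (m : R) :
  (gauss m).-integrable setT (fun x => (x - m)%:E).
Proof.
have mexp : measurable_fun setT (fun y : R => (expR y)%:E).
  by apply/measurable_EFinP.
have mf : measurable_fun setT (fun y => (gauss_pdf D 0 y)%:E).
  by apply/measurable_EFinP; exact: measurable_gauss_pdf.
have mN : measurable_fun setT (fun y : R => (expR (- y))%:E).
  by apply/measurable_EFinP; apply: measurableT_comp => //; exact: measurable_funN.
apply/integrableP; split; first by apply/measurable_EFinP; exact: measurable_funB.
rewrite (ge0_integral_gauss_center m (g := fun y => `|y%:E|%E)); last 2 first.
- by apply: measurableT_comp => //; apply/measurable_EFinP.
- by move=> y; exact: abse_ge0.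
apply: (@le_lt_trans _ _ (\int[mu]_y
  ((expR y)%:E * (gauss_pdf D 0 y)%:E + (expR (- y))%:E * (gauss_pdf D 0 y)%:E))%E).
  apply: ge0_le_integral => //.
  - by move=> y _; rewrite mule_ge0// lee_fin gauss_pdf_ge0.
  - apply: emeasurable_funM => //.
    by apply: measurableT_comp => //; apply/measurable_EFinP.
  - by apply: emeasurable_funD; exact: emeasurable_funM.
  - move=> y _; rewrite -ge0_muleDl; last 2 first.
    + by rewrite lee_fin expR_ge0.
    + by rewrite lee_fin expR_ge0.
    apply: lee_wpmul2r; first by rewrite lee_fin gauss_pdf_ge0.
    rewrite -EFinD abse_EFin lee_fin.
    have := expR_ge1Dx y; have := expR_ge1Dx (- y).
    have := expR_ge0 y; have := expR_ge0 (- y).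
    by case: (ler0P y) => _; lra.
rewrite ge0_integralD; last 5 first.
- exact: measurableT.
- by move=> y _; rewrite mule_ge0// lee_fin ?expR_ge0 ?gauss_pdf_ge0.
- exact: emeasurable_funM.
- by move=> y _; rewrite mule_ge0// lee_fin ?expR_ge0 ?gauss_pdf_ge0.
- exact: emeasurable_funM.
rewrite (gauss_integralN mexp); last by move=> y; rewrite lee_fin expR_ge0.
by rewrite gauss_expR -EFinD ltry.
Qed.

(** Reflection exchanges the positive and the negative part, so their integrals are equal;
    integrability makes them finite, and they cancel. *)
Lemma integral_gauss_centered (m : R) : (\int[gauss m]_x (x - m)%:E = 0)%E.
Proof.
have mp : measurable_fun setT (fun y : R => maxe y%:E 0).
  by apply: measurable_maxe => //; apply/measurable_EFinP.
have p0 (y : R) : (0 <= maxe y%:E 0)%E by rewrite le_max lexx orbT.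
have posE : (\int[gauss m]_x (fun x => (x - m)%:E)^\+ x =
    \int[gauss m]_x (fun x => (x - m)%:E)^\- x)%E.
  transitivity (\int[mu]_y (maxe y%:E 0 * (gauss_pdf D 0 y)%:E))%E.
    rewrite -(ge0_integral_gauss_center m mp p0).
    by apply: eq_integral => x _; rewrite funeposE.
  rewrite -(gauss_integralN mp p0); apply/esym.
  rewrite -(ge0_integral_gauss_center m (g := fun y => maxe (- y)%:E 0)).
  - by apply: eq_integral => x _; rewrite funenegE.
  - by apply: measurable_maxe => //; apply/measurable_EFinP; exact: measurable_funN.
  - by move=> y; rewrite le_max lexx orbT.
rewrite integralE posE subee//.
have /integrable_funeneg := integrable_gauss_centered m.
by move=> /(_ measurableT)/integrable_fin_num; exact.
Qed.

Lemma integrable_gauss_addc (m c : R) :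
  (gauss m).-integrable setT (fun x => (x + c)%:E).
Proof.
have := integrableD measurableT (integrable_gauss_centered m)
  (finite_measure_integrable_cst (gauss m) (m + c) measurableT).
by apply: eq_integrable => // x _ /=; rewrite -EFinD addrA subrK.
Qed.

Lemma Rintegral_gauss_addc (m c : R) : \int[gauss m]_x (x + c) = m + c.
Proof.
transitivity (\int[gauss m]_x ((x - m) + (m + c))).
  by apply: eq_Rintegral => x _; rewrite addrA subrK.
rewrite RintegralD; last 3 first.
- exact: measurableT.
- exact: integrable_gauss_centered.
- exact: (finite_measure_integrable_cst (gauss m) (m + c) measurableT).
rewrite {1}/Rintegral integral_gauss_centered add0r Rintegral_cst//.
rewrite -[RHS]mulr1; congr (_ * _).
exact: (congr1 fine (integral_normal_pdf m (Num.sqrt D))).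
Qed.

(** * Averaging a nonnegative function of the statistic over one income *)

Section GaussAverage.
Context (L : R * R -> R) (B : R -> R).
Hypotheses (mL : measurable_fun setT L) (L0 : forall p, 0 <= L p)
  (LB : forall m X, L (m, X) <= B m).

Let mLX (m X : R) : measurable_fun setT (fun x : R => (L (m, (X + x)%R))%:E).
Proof.
apply/measurable_EFinP/(measurableT_comp mL)/measurable_fun_pair => //.
exact: measurable_funD.
Qed.

Lemma gauss_average_lebesgue (m X : R) : (\int[gauss m]_x (L (m, (X + x)%R))%:E =
  \int[mu]_x ((L (m, (X + x)%R))%:E * (gauss_pdf D m x)%:E))%E.
Proof. by apply: ge0_integral_normal_prob => // x; rewrite lee_fin. Qed.

Lemma gauss_average_bounded (m X : R) :
  (\int[gauss m]_x (L (m, (X + x)%R))%:E <= (B m)%:E)%E.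
Proof.
apply: (@le_trans _ _ (\int[gauss m]_x (cst (B m)%:E) x)%E).
  apply: ge0_le_integral => //.
  - by move=> x _; rewrite lee_fin.
  - exact: mLX.
  - by move=> x _; rewrite lee_fin LB.
rewrite integral_cst; last exact: measurableT.
rewrite -[leRHS]mule1 le_eqVlt; apply/orP; left; apply/eqP.
congr (_ * _)%E; exact: integral_normal_pdf.
Qed.

Lemma gauss_average_ge0 (m X : R) : 0 <= \int[gauss m]_x L (m, (X + x)%R).
Proof. by apply: Rintegral_ge0 => x _; exact: L0. Qed.

Lemma EFin_gauss_average (m X : R) : (\int[gauss m]_x L (m, (X + x)%R))%:E =
  (\int[gauss m]_x (L (m, (X + x)%R))%:E)%E.
Proof.
rewrite /Rintegral fineK// ge0_fin_numE; last first.
  by apply: integral_ge0 => x _; rewrite lee_fin.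
by rewrite (le_lt_trans (gauss_average_bounded m X))// ltry.
Qed.

Lemma gauss_average_le (m X : R) : \int[gauss m]_x L (m, (X + x)%R) <= B m.
Proof. by rewrite -lee_fin EFin_gauss_average gauss_average_bounded. Qed.

Lemma integrable_gauss_average (m X : R) :
  (gauss m).-integrable setT (fun x : R => (L (m, (X + x)%R))%:E).
Proof.
apply/integrableP; split; first exact: mLX.
apply: (@le_lt_trans _ _ (B m)%:E); last by rewrite ltry.
apply: le_trans (gauss_average_bounded m X).
rewrite le_eqVlt; apply/orP; left; apply/eqP/eq_integral => x _.
by rewrite gee0_abs// lee_fin.
Qed.

(** The measure itself varies with the mean [p.1]. Moving this dependence into a jointly measurable
    density turns the average into a Tonelli section over the fixed measure [mu]. *)
Lemma measurable_gauss_average :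
  measurable_fun setT (fun p : R * R => \int[gauss p.1]_x L (p.1, p.2 + x)).
Proof.
pose f (q : (R * R) * R) :=
  ((L (q.1.1, (q.1.2 + q.2)%R))%:E * (gauss_pdf D 0 (q.2 - q.1.1)%R)%:E)%E.
have mf : measurable_fun setT f.
  have m11 : measurable_fun setT (fun q : (R * R) * R => q.1.1).
    exact: (measurableT_comp measurable_fst measurable_fst).
  have m12 : measurable_fun setT (fun q : (R * R) * R => q.1.2).
    exact: (measurableT_comp measurable_snd measurable_fst).
  apply: emeasurable_funM; apply/measurable_EFinP.
    apply/(measurableT_comp mL)/measurable_fun_pair => //.
    exact: measurable_funD.
  apply: (measurableT_comp (measurable_gauss_pdf D 0)).
  exact: measurable_funB.
have f0 q : (0 <= f q)%E by rewrite /f mule_ge0// lee_fin ?gauss_pdf_ge0.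
have -> : (fun p : R * R => \int[gauss p.1]_x L (p.1, p.2 + x)) =
          fine \o fubini_F mu f.
  apply/funext => p /=; congr fine; rewrite gauss_average_lebesgue.
  by apply: eq_integral => x _; rewrite /f/= (gauss_pdf_center _ _ D0).
by apply: measurableT_comp => //; exact: measurable_fun_fubini_tonelli_F.
Qed.

End GaussAverage.
End NormalExpectation.

(** * Regret of a strategy *)

Section Regret.
Context {R : realType} (M : nat) (D : R) (D0 : 0 < D) (sigma : strategy R).
Local Notation gauss m := (normal_prob m (Num.sqrt D)).

(** The analogue of [prob_arm1] in terms of the statistics and the last action [a], which is all
    that a strategy sees of the history. *)
Definition select_prob (k : nat) (X : R) (n : nat) (a : arm) : R :=
  if (M %| k)%N && (M %| n)%N then sigma k X n else (is_arm1 a)%:R.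

Lemma select_prob_itv k X n a : 0 <= select_prob k X n a <= 1.
Proof.
rewrite /select_prob; case: ifP => _; first exact: select1_prob.
by case: a => /=; rewrite lexx ler01.
Qed.

Lemma measurable_select_prob k n a :
  measurable_fun setT (fun X => select_prob k X n a).
Proof. by rewrite /select_prob; case: (_ && _) => //; exact: select1_meas. Qed.

(* Expected loss of the remaining [t] steps after a history with statistics
   [(k, X, n)] and last action [a]. *)
Fixpoint regret (t : nat) (m : R) (k : nat) (X : R) (n : nat) (a : arm) : R :=
  if t is t'.+1 then
    select_prob k X n a * (Num.max 0 m + regret t' m k.+1 X n Arm1) +
    (1 - select_prob k X n a) *
      (Num.max 0 (- m) + \int[gauss m]_x regret t' m k (X + x) n.+1 Arm2)
  else 0.

(** Each step costs at most the absolute value of [m]. The three facts go through one induction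
    because bounding the Gaussian average of the next step also requires measurability and
    nonnegativity. *)
Lemma regret_bounded t k n a :
  [/\ measurable_fun setT (fun p : R * R => regret t p.1 k p.2 n a),
      (forall m X, 0 <= regret t m k X n a) &
      (forall m X, regret t m k X n a <= t%:R * `|m|)].
Proof.
elim: t k n a => [|t IH] k n a /=.
  by split => // m X; rewrite ?mul0r.
have [mL1 L10 L1B] := IH k.+1 n Arm1.
have [mL2 L20 L2B] := IH k n.+1 Arm2.
pose L p := regret t p.1 k p.2 n.+1 Arm2.
have L0 p : 0 <= L p by exact: L20.
pose p1 (z : R * R) := select_prob k z.2 n a.
have mp1 : measurable_fun setT p1.
  exact: (measurableT_comp (measurable_select_prob k n a)).
have mmax : measurable_fun setT (fun z : R * R => Num.max 0 z.1).
  exact: measurable_maxr.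
have mmaxN : measurable_fun setT (fun z : R * R => Num.max 0 (- z.1)).
  by apply: measurable_maxr => //; exact: measurableT_comp.
split.
- apply: measurable_funD; apply: measurable_funM => //.
  + exact: measurable_funD.
  + exact: measurable_funB.
  + apply: measurable_funD => //.
    exact: (measurable_gauss_average D0 mL2 L0).
- move=> m X; have /andP[p0 p1'] := select_prob_itv k X n a.
  by rewrite addr_ge0// mulr_ge0 ?subr_ge0// addr_ge0 ?le_max ?lexx//
    (gauss_average_ge0 D L0).
- move=> m X; have /andP[p0 p1'] := select_prob_itv k X n a.
  have H1 := L1B m X; have H2 := gauss_average_le D mL2 L0 L2B m X.
  have A1 : Num.max 0 m <= `|m| by rewrite ge_max normr_ge0 ler_norm.
  have A2 : Num.max 0 (- m) <= `|m| by rewrite ge_max normr_ge0 -normrN ler_norm.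
  have -> : t.+1%:R * `|m| = select_prob k X n a * (`|m| + t%:R * `|m|) +
      (1 - select_prob k X n a) * (`|m| + t%:R * `|m|).
    by rewrite -natr1; ring.
  by apply: lerD; apply: ler_wpM2l; rewrite ?subr_ge0//; apply: lerD.
Qed.

Lemma measurable_regret t k n a :
  measurable_fun setT (fun p : R * R => regret t p.1 k p.2 n a).
Proof. by have [] := regret_bounded t k n a. Qed.

Lemma regret_ge0 t m k X n a : 0 <= regret t m k X n a.
Proof. by have [_ +] := regret_bounded t k n a. Qed.

Lemma regret_le t m k X n a : regret t m k X n a <= t%:R * `|m|.
Proof. by have [_ _ +] := regret_bounded t k n a. Qed.

(** [Arm2] on the empty history matches the default value [0] of [prob_arm1]. *)
Definition last_arm (h : history R) : arm := if h is s :: _ then s.1 else Arm2.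

Lemma prob_arm1E (h : history R) : prob_arm1 M sigma h =
  select_prob (count1 h) (income2 h) (count2 h) (last_arm h).
Proof. by case: h => [|s h]; rewrite /prob_arm1 /select_prob; case: ifP. Qed.

Lemma Rintegral_addc (P : probability R R) (c : R) :
  P.-integrable setT (fun x => x%:E) -> \int[P]_x (x + c) = \int[P]_x x + c.
Proof.
move=> iP; rewrite RintegralD//; last exact: finite_measure_integrable_cst.
rewrite Rintegral_cst; last exact: measurableT.
by rewrite -[c in RHS]mulr1; congr (_ + c * _); exact: (congr1 fine (probability_setT P)).
Qed.

(** Measured against the better mean [Num.max 0 m], a step with the first arm forfeits [Num.max 0 m]
    and one with the second forfeits [Num.max 0 m - m = Num.max 0 (- m)]: the two step costs of
    [regret]. *)
Lemma expect_total_income (nu : probability R R) m t (h : history R) :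
  nu.-integrable setT (fun x => x%:E) -> \int[nu]_x x = 0 ->
  expect M D nu sigma m total_income t h =
  total_income h + t%:R * Num.max 0 m -
  regret t m (count1 h) (income2 h) (count2 h) (last_arm h).
Proof.
move=> inu nu0; elim: t h => [|t IH] h /=; first by rewrite mul0r addr0 subr0.
set k := count1 h; set n := count2 h; set X := income2 h.
pose L p := regret t p.1 k p.2 n.+1 Arm2.
have totE a x : total_income ((a, x) :: h) = x + total_income h.
  by rewrite /total_income big_cons.
have -> : \int[nu]_x expect M D nu sigma m total_income t ((Arm1, x) :: h) =
    total_income h + t%:R * Num.max 0 m - regret t m k.+1 X n Arm1.
  (* An income of the first arm leaves the statistics unchanged, so it enters only additively, with
     mean zero. *)
  set c := (X in _ = X); transitivity (\int[nu]_x (x + c)).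
    apply: eq_Rintegral => x _.
    rewrite IH totE /income2 big_cons/= /count1/= /count2/= add1n add0n.
    by rewrite /c -!addrA.
  by rewrite Rintegral_addc// nu0 add0r.
have -> : \int[gauss m]_x expect M D nu sigma m total_income t ((Arm2, x) :: h) =
    m + (total_income h + t%:R * Num.max 0 m) -
    \int[gauss m]_x regret t m k (X + x) n.+1 Arm2.
  have iL := integrable_gauss_average D (measurable_regret t k n.+1 Arm2)
    (fun p => regret_ge0 t p.1 k p.2 n.+1 Arm2)
    (fun m X => regret_le t m k X n.+1 Arm2) m X.
  set c := total_income h + _.
  transitivity (\int[gauss m]_x (x + c) -
      \int[gauss m]_x regret t m k (X + x) n.+1 Arm2); last first.
    by rewrite Rintegral_gauss_addc.
  rewrite -RintegralB; last 3 first.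
  - exact: measurableT.
  - exact: integrable_gauss_addc.
  - exact: iL.
  apply: eq_Rintegral => x _.
  rewrite IH totE /income2 big_cons/= /count1/= /count2/= add1n add0n.
  by rewrite /c -!addrA [x + income2 h]addrC.
rewrite prob_arm1E -/k -/n -/X.
have -> : Num.max 0 (- m) = Num.max 0 m - m.
  have [m0|/ltW m0] := lerP 0 m.
    by rewrite max_l ?oppr_le0// subrr.
  by rewrite max_r ?oppr_ge0// sub0r.
by rewrite -[t.+1%:R]natr1; ring.
Qed.

End Regret.

(** * Posterior integrals and the batch recursion *)

Section Prior.
Context {R : realType} (C D : R) (lam : R -> R) (D0 : 0 < D) (C0 : 0 < C).
Hypotheses (lam_meas : measurable_fun `[- C, C] lam)
  (lam_ge0 : forall m : R, - C <= m <= C -> 0 <= lam m)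
  (lam_mass : (\int[lebesgue_measure]_(m in `[(- C)%R, C]) (lam m)%:E = 1)%E).
Local Notation mu := (@lebesgue_measure R).
Local Notation g1 := (g1 C D lam).
Local Notation g2 := (g2 C D lam).

(** Extension by zero, so that posterior integrals run over the whole line and Tonelli applies on
    the product. *)
Definition prior : R -> R := lam \_ `[- C, C].

Lemma priorE m : prior m = if - C <= m <= C then lam m else 0.
Proof. by rewrite /prior patchE mem_setE in_itv. Qed.

Lemma prior_ge0 m : 0 <= prior m.
Proof. by rewrite priorE; case: ifP => // /lam_ge0. Qed.

Lemma measurable_prior : measurable_fun setT prior.
Proof. exact: (measurable_restrictT lam (measurable_itv _)).1 lam_meas. Qed.

(* Posterior density of [m], up to a factor independent of [m]. *)
Definition weight (m X : R) (n : nat) : R :=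
  prior m * expR (D^-1 * (X * m - 2^-1 * n%:R * m ^+ 2)).

Lemma weight_ge0 m X n : 0 <= weight m X n.
Proof. by rewrite mulr_ge0 ?prior_ge0 ?expR_ge0. Qed.

Lemma measurable_weight n : measurable_fun setT (fun p : R * R => weight p.1 p.2 n).
Proof.
apply: measurable_funM; first exact: (measurableT_comp measurable_prior).
apply: measurableT_comp => //; apply: measurable_funM => //.
apply: measurable_funB; first exact: measurable_funM.
by apply: measurable_funM => //; exact: measurable_funX.
Qed.

(** Bayesian updating: the likelihood ratio of the observation [x] is absorbed into the weight, and
    the remaining density no longer depends on [m]. *)
Lemma weight_tilt m X n x : weight m X n * gauss_pdf D m x =
  weight m (X + x) n.+1 * gauss_pdf D 0 x.
Proof.
rewrite (gauss_pdf_tilt _ _ D0) /weight mulrACA [RHS]mulrAC -expRD.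
by congr (_ * expR _); rewrite -natr1; ring.
Qed.

Definition post (phi : R -> R -> R) (X : R) (n : nat) : \bar R :=
  (\int[mu]_m (weight m X n * phi m X)%:E)%E.

Section Post.
Context (phi : R -> R -> R).
Hypotheses (mphi : measurable_fun setT (fun p : R * R => phi p.1 p.2))
  (phi0 : forall m X, 0 <= phi m X).

Lemma post_ge0 X n : (0 <= post phi X n)%E.
Proof.
by apply: integral_ge0 => m _; rewrite lee_fin mulr_ge0 ?weight_ge0.
Qed.

Lemma measurable_post n : measurable_fun setT (fun X => post phi X n).
Proof.
apply: (measurable_fun_fubini_tonelli_G (m1 := mu)
  (fun p : R * R => (weight p.1 p.2 n * phi p.1 p.2)%:E)).
- by apply/measurable_EFinP/measurable_funM => //; exact: measurable_weight.
- by move=> p; rewrite lee_fin mulr_ge0 ?weight_ge0.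
Qed.

Lemma measurable_post_integrand X n :
  measurable_fun setT (fun m => (weight m X n * phi m X)%:E).
Proof.
have mX : measurable_fun setT (fun m : R => (m, X)) by exact: measurable_fun_pair.
apply/measurable_EFinP/measurable_funM.
- exact: (measurableT_comp (measurable_weight n) mX).
- exact: (measurableT_comp mphi mX).
Qed.

Lemma post_bounded (B X : R) n : 0 <= B ->
  (forall m, `|m| <= C -> phi m X <= B) ->
  (post phi X n <= (B * expR (D^-1 * (`|X| * C)))%:E)%E.
Proof.
move=> B0 phiB; set K := B * _.
have K0 : 0 <= K by rewrite mulr_ge0// expR_ge0.
have mprior : measurable_fun setT (fun m => (prior m)%:E).
  by apply/measurable_EFinP; exact: measurable_prior.
have <- : (\int[mu]_m (K%:E * (prior m)%:E) = K%:E)%E.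
  rewrite ge0_integralZl//.
  - rewrite -[RHS]mule1 -lam_mass [in RHS]integral_mkcond; congr (_ * _)%E.
    by apply: eq_integral => m _; rewrite restrict_EFin.
  - by move=> m _; rewrite lee_fin prior_ge0.
apply: ge0_le_integral => //.
- by move=> m _; rewrite lee_fin mulr_ge0 ?weight_ge0.
- exact: measurable_post_integrand.
- exact: emeasurable_funM.
move=> m _; rewrite -EFinM lee_fin /weight -mulrA mulrC.
have := prior_ge0 m; rewrite priorE.
case: ifP => [mC lam0|_ _]; last by rewrite !mulr0.
apply: ler_wpM2r => //; rewrite mulrC; have mC' : `|m| <= C by rewrite ler_norml.
apply: ler_pM; [exact: phi0|exact: expR_ge0|exact: phiB|].
rewrite ler_expR; apply: ler_wpM2l; first by rewrite invr_ge0 ltW.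
rewrite lerBlDr.
apply: (@le_trans _ _ (`|X| * C)).
  by rewrite (le_trans (ler_norm _))// normrM ler_wpM2l.
by rewrite lerDl mulr_ge0 ?sqr_ge0// mulr_ge0.
Qed.

End Post.

Lemma postD (phi psi : R -> R -> R) X n :
  measurable_fun setT (fun p : R * R => phi p.1 p.2) ->
  measurable_fun setT (fun p : R * R => psi p.1 p.2) ->
  (forall m x, 0 <= phi m x) -> (forall m x, 0 <= psi m x) ->
  post (fun m x => phi m x + psi m x) X n = (post phi X n + post psi X n)%E.
Proof.
move=> mphi mpsi phi0 psi0; rewrite /post -ge0_integralD; last 5 first.
- exact: measurableT.
- by move=> m _; rewrite lee_fin mulr_ge0 ?weight_ge0.
- exact: measurable_post_integrand.
- by move=> m _; rewrite lee_fin mulr_ge0 ?weight_ge0.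
- exact: measurable_post_integrand.
by apply: eq_integral => m _; rewrite mulrDr EFinD.
Qed.

(** The factor may depend on the income but not on [m], as a selection probability does. *)
Lemma postZ (phi : R -> R -> R) (c : R -> R) X n :
  measurable_fun setT (fun p : R * R => phi p.1 p.2) ->
  (forall m x, 0 <= phi m x) -> 0 <= c X ->
  post (fun m x => c x * phi m x) X n = ((c X)%:E * post phi X n)%E.
Proof.
move=> mphi phi0 c0; rewrite /post -ge0_integralZl; last 4 first.
- exact: measurableT.
- exact: measurable_post_integrand.
- by move=> m _; rewrite lee_fin mulr_ge0 ?weight_ge0.
- by [].
by apply: eq_integral => m _; rewrite mulrCA EFinM.
Qed.

(* Bayes' rule for one observation of the second arm: averaging over its law
   given [m] and then over [m] amounts to smoothing the updated posterior. *)
Lemma post_average (phi : R -> R -> R) (B : R -> R) X n :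
  measurable_fun setT (fun p : R * R => phi p.1 p.2) ->
  (forall m x, 0 <= phi m x) -> (forall m x, phi m x <= B m) ->
  post (fun m x => \int[normal_prob m (Num.sqrt D)]_y phi m (x + y)) X n =
  gauss_smooth D (fun x => post phi x n.+1) X.
Proof.
move=> mphi phi0 phiB.
(* Both sides are iterated integrals of this [f], in opposite orders. *)
pose f (p : R * R) :=
  (weight p.1 (X + p.2) n.+1 * phi p.1 (X + p.2) * gauss_pdf D 0 p.2)%:E.
have mX : measurable_fun setT (fun p : R * R => (p.1, X + p.2)).
  by apply: measurable_fun_pair => //; exact: measurable_funD.
have mf : measurable_fun setT f.
  apply/measurable_EFinP/measurable_funM; first apply: measurable_funM.
  - exact: (measurableT_comp (measurable_weight n.+1) mX).
  - exact: (measurableT_comp mphi mX).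
  - by apply: (measurableT_comp (measurable_gauss_pdf D 0)).
have f0 p : (0 <= f p)%E.
  by rewrite lee_fin mulr_ge0 ?gauss_pdf_ge0// mulr_ge0 ?weight_ge0.
transitivity (\int[mu]_m \int[mu]_x f (m, x))%E.
  apply: eq_integral => m _.
  rewrite EFinM (EFin_gauss_average D (L := fun p => phi p.1 p.2) mphi _ phiB)//.
  rewrite (gauss_average_lebesgue D (L := fun p => phi p.1 p.2) mphi)//.
  rewrite -ge0_integralZl; last 4 first.
  - exact: measurableT.
  - apply/emeasurable_funM; apply/measurable_EFinP; last exact: measurable_gauss_pdf.
    apply: (measurableT_comp mphi); apply: measurable_fun_pair => //.
    exact: measurable_funD.
  - by move=> x _; rewrite mule_ge0// lee_fin ?gauss_pdf_ge0.
  - by rewrite lee_fin weight_ge0.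
  apply: eq_integral => x _; rewrite -!EFinM; congr (_%:E).
  by rewrite [phi _ _ * _]mulrC mulrA weight_tilt /= mulrAC.
rewrite fubini_tonelli; [|exact: mf|exact: f0].
apply: eq_integral => x _.
rewrite -ge0_integralZr; last 4 first.
- exact: measurableT.
- exact: measurable_post_integrand.
- by move=> m _; rewrite lee_fin mulr_ge0 ?weight_ge0.
- by rewrite lee_fin gauss_pdf_ge0.
by apply: eq_integral => m _; rewrite -EFinM.
Qed.

(** [pos] and [neg] are the one-step costs of the first and the second arm, written in the shape
    that [post] expects. *)
Let pos (m _ : R) : R := Num.max 0 m.
Let neg (m _ : R) : R := Num.max 0 (- m).

Let measurable_pos : measurable_fun setT (fun p : R * R => pos p.1 p.2).
Proof. exact: measurable_maxr. Qed.

Let measurable_neg : measurable_fun setT (fun p : R * R => neg p.1 p.2).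
Proof. by apply: measurable_maxr => //; exact: measurableT_comp. Qed.

Let pos_ge0 m x : 0 <= pos m x. Proof. by rewrite le_max lexx. Qed.

Let neg_ge0 m x : 0 <= neg m x. Proof. by rewrite le_max lexx. Qed.

Let pos_le m x : pos m x <= `|m|.
Proof. by rewrite ge_max normr_ge0 ler_norm. Qed.

Let neg_le m x : neg m x <= `|m|.
Proof. by rewrite ge_max normr_ge0 -normrN ler_norm. Qed.

(** As [g1] is a real-valued integral, finiteness of the extended one is checked first; then
    [Num.max 0 m] and the prior cut the line down to [[0, C]]. *)
Lemma post_pos X n : post (fun m _ => Num.max 0 m) X n = (g1 X n)%:E.
Proof.
have fin : post pos X n \is a fin_num.
  rewrite ge0_fin_numE; last exact: post_ge0.
  apply: (le_lt_trans (post_bounded measurable_pos pos_ge0 n (ltW C0) _)).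
    by move=> m mC; exact: le_trans (pos_le m X) mC.
  by rewrite ltry.
rewrite -[LHS]fineK//; congr (fine _)%:E; rewrite [RHS]integral_mkcond.
apply: eq_integral => m _; rewrite patchE mem_setE in_itv/= /weight priorE.
have [m0|m0] /= := lerP 0 m; last by rewrite mulr0.
have -> : - C <= m by rewrite (le_trans _ m0)// oppr_le0 ltW.
rewrite /=; case: ifP => _; last by rewrite !mul0r.
by congr (_%:E); rewrite mulrAC [RHS]mulrAC [_ * lam m]mulrC.
Qed.

Lemma post_neg X n : post (fun m _ => Num.max 0 (- m)) X n = (g2 X n)%:E.
Proof.
have fin : post neg X n \is a fin_num.
  rewrite ge0_fin_numE; last exact: post_ge0.
  apply: (le_lt_trans (post_bounded measurable_neg neg_ge0 n (ltW C0) _)).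
    by move=> m mC; exact: le_trans (neg_le m X) mC.
  by rewrite ltry.
rewrite -[LHS]fineK//; congr (fine _)%:E; rewrite [RHS]integral_mkcond.
apply: eq_integral => m _; rewrite patchE mem_setE in_itv/= /weight priorE.
have [m0|m0] := lerP m 0; last first.
  by rewrite andbF max_l ?mulr0// oppr_le0 ltW.
rewrite max_r ?oppr_ge0// andbT ler0_norm//.
have -> : m <= C by rewrite (le_trans m0)// ltW.
rewrite andbT; case: ifP => _ /=; last by rewrite !mul0r.
by congr (_%:E); rewrite mulrAC [RHS]mulrAC [_ * lam m]mulrC.
Qed.

Lemma g1_ge0 X n : 0 <= g1 X n.
Proof. by rewrite -lee_fin -post_pos; exact: post_ge0. Qed.

Lemma g2_ge0 X n : 0 <= g2 X n.
Proof. by rewrite -lee_fin -post_neg; exact: post_ge0. Qed.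

Lemma measurable_g1 n : measurable_fun setT (fun X => g1 X n).
Proof.
apply/measurable_EFinP; have := measurable_post measurable_pos pos_ge0 n.
by under eq_fun do rewrite post_pos.
Qed.

Lemma measurable_g2 n : measurable_fun setT (fun X => g2 X n).
Proof.
apply/measurable_EFinP; have := measurable_post measurable_neg neg_ge0 n.
by under eq_fun do rewrite post_neg.
Qed.

Let average_cst (m c : R) : \int[normal_prob m (Num.sqrt D)]_y c = c.
Proof.
rewrite Rintegral_cst; last exact: measurableT.
rewrite -[RHS]mulr1; congr (_ * _).
exact: (congr1 fine (integral_normal_pdf m (Num.sqrt D))).
Qed.

(** A martingale property: averaging over an income fixes a function of [m] alone, so Bayes' rule
    [post_average] carries its posterior integral from [n.+1] back to [n]. *)
Lemma gauss_smooth_g1 X n :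
  gauss_smooth D (fun x => (g1 x n.+1)%:E) X = (g1 X n)%:E.
Proof.
have -> : (fun x => (g1 x n.+1)%:E) = (fun x => post pos x n.+1).
  by apply/funext => x; rewrite post_pos.
rewrite -post_pos.
rewrite -(post_average _ _ measurable_pos pos_ge0 pos_le).
by apply: eq_integral => m _; rewrite average_cst.
Qed.

Lemma gauss_smooth_g2 X n :
  gauss_smooth D (fun x => (g2 x n.+1)%:E) X = (g2 X n)%:E.
Proof.
have -> : (fun x => (g2 x n.+1)%:E) = (fun x => post neg x n.+1).
  by apply/funext => x; rewrite post_neg.
rewrite -post_neg.
rewrite -(post_average _ _ measurable_neg neg_ge0 neg_le).
by apply: eq_integral => m _; rewrite average_cst.
Qed.

(** * Posterior regret of a strategy and its recursion *)

Section Value.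
Context (M : nat) (M0 : (0 < M)%N) (sigma : strategy R).

Definition value (t k : nat) (X : R) (n : nat) (a : arm) : \bar R :=
  post (fun m x => regret M D sigma t m k x n a) X n.

Lemma value_ge0 t k X n a : (0 <= value t k X n a)%E.
Proof. by apply: post_ge0 => m x; exact: regret_ge0. Qed.

Lemma measurable_value t k n a : measurable_fun setT (fun X => value t k X n a).
Proof.
apply: (measurable_post (phi := fun m x => regret M D sigma t m k x n a)).
  exact: measurable_regret.
by move=> m x; exact: regret_ge0.
Qed.

(** The selection probability does not depend on [m] and leaves the posterior integral;
    [post_average] converts the expected regret after the second arm into a smoothing. *)
Lemma value_step t k X n a :
  value t.+1 k X n a =
  ((select_prob M sigma k X n a)%:E * ((g1 X n)%:E + value t k.+1 X n Arm1) +
   (1 - select_prob M sigma k X n a)%:E *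
     ((g2 X n)%:E + gauss_smooth D (fun x => value t k x n.+1 Arm2) X))%E.
Proof.
pose c x := select_prob M sigma k x n a.
have mc : measurable_fun setT (fun p : R * R => c p.2).
  exact: (measurableT_comp (measurable_select_prob M sigma k n a)).
have c0 x : 0 <= c x by have /andP[] := select_prob_itv M sigma k x n a.
have c1 x : 0 <= 1 - c x.
  by rewrite subr_ge0; have /andP[] := select_prob_itv M sigma k x n a.
pose L1 m x := regret M D sigma t m k.+1 x n Arm1.
pose L2 m x := regret M D sigma t m k x n.+1 Arm2.
have mL1 := measurable_regret M D0 sigma t k.+1 n Arm1.
have mL2 := measurable_regret M D0 sigma t k n.+1 Arm2.
have L10 m x : 0 <= L1 m x by exact: regret_ge0.
have L20 m x : 0 <= L2 m x by exact: regret_ge0.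
pose A m x := \int[normal_prob m (Num.sqrt D)]_y L2 m (x + y).
have mA : measurable_fun setT (fun p : R * R => A p.1 p.2).
  by apply: (measurable_gauss_average D0 mL2) => p; exact: L20.
have A0 m x : 0 <= A m x.
  by apply: (gauss_average_ge0 D (L := fun p => L2 p.1 p.2)) => p; exact: L20.
transitivity (post (fun m x => c x * (pos m x + L1 m x) +
                               (1 - c x) * (neg m x + A m x)) X n).
  by [].
have mP1 : measurable_fun setT (fun p : R * R => pos p.1 p.2 + L1 p.1 p.2).
  exact: measurable_funD.
have mP2 : measurable_fun setT (fun p : R * R => neg p.1 p.2 + A p.1 p.2).
  exact: measurable_funD.
have P10 m x : 0 <= pos m x + L1 m x by rewrite addr_ge0.
have P20 m x : 0 <= neg m x + A m x by rewrite addr_ge0.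
rewrite postD; last 4 first.
- exact: measurable_funM.
- by apply: measurable_funM => //; exact: measurable_funB.
- by move=> m x; rewrite mulr_ge0.
- by move=> m x; rewrite mulr_ge0.
rewrite (postZ _ mP1 P10 (c0 X)) (postZ (c := fun x => 1 - c x) _ mP2 P20 (c1 X)).
rewrite (postD _ _ measurable_pos mL1 pos_ge0 L10).
rewrite (postD _ _ measurable_neg mA neg_ge0 A0).
rewrite post_pos post_neg.
rewrite (post_average _ _ mL2 L20 (fun m x => regret_le M D0 sigma t m k x n.+1 Arm2)).
by [].
Qed.

(** Here [j] steps of the current batch remain. As long as [j] is positive, [k] is not a multiple of
    [M], so the first arm is repeated with the same [X] and [n]. *)
Lemma value_run1 t j k X n : (j < M)%N -> (M %| k + j)%N ->
  value (t + j) k X n Arm1 = ((j%:R * g1 X n)%:E + value t (k + j) X n Arm1)%E.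
Proof.
elim: j k => [|j IH] k jM Mk; first by rewrite !addn0 mul0r add0e.
rewrite addnS value_step /select_prob.
have -> : (M %| k)%N = false.
  apply/negbTE/negP => Mk'; move: Mk; rewrite dvdn_addr// => /(dvdn_leq (ltn0Sn j)).
  by rewrite leqNgt jM.
rewrite /= subrr mul0e adde0 mul1e IH ?(ltnW jM) ?addSnnS//.
by rewrite addeA -EFinD -natr1 mulrDl mul1r [g1 X n + _]addrC.
Qed.

Lemma iter_gauss_smooth_value t k n a j :
  let u := iter j (gauss_smooth D) (fun x => value t k x n a) in
  measurable_fun setT u /\ (forall x, 0 <= u x)%E.
Proof.
elim: j => [|j [mu_ u0]] /=.
  by split=> [|x]; [exact: measurable_value|exact: value_ge0].
by split=> [|x]; [exact: measurable_gauss_smooth|exact: gauss_smooth_ge0].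
Qed.

(** Costs of later steps with the second arm, smoothed back to the present, equal the present cost;
    this lets them add up along a run. *)
Lemma gauss_smooth_g2D (c : R) u X n : 0 <= c ->
  measurable_fun setT u -> (forall x, 0 <= u x)%E ->
  gauss_smooth D (fun x => ((c * g2 x n.+1)%:E + u x)%E) X =
  ((c * g2 X n)%:E + gauss_smooth D u X)%E.
Proof.
move=> c0 mu_ u0.
have mg : measurable_fun setT (fun x => (g2 x n.+1)%:E).
  by apply/measurable_EFinP; exact: measurable_g2.
rewrite gauss_smoothD//; last 2 first.
- by apply/measurable_EFinP/measurable_funM => //; exact: measurable_g2.
- by move=> x; rewrite lee_fin mulr_ge0// g2_ge0.
congr (_ + _)%E.
transitivity (gauss_smooth D (fun x => c%:E * (g2 x n.+1)%:E)%E X); first by [].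
rewrite (gauss_smoothZ _ _ mg _ c0) ?gauss_smooth_g2// => x.
by rewrite lee_fin g2_ge0.
Qed.

Lemma value_run2 t j k X n : (j < M)%N -> (M %| n + j)%N ->
  value (t + j) k X n Arm2 =
  ((j%:R * g2 X n)%:E +
   iter j (gauss_smooth D) (fun x => value t k x (n + j) Arm2) X)%E.
Proof.
elim: j n X => [|j IH] n X jM Mn; first by rewrite !addn0 mul0r add0e.
rewrite addnS value_step /select_prob.
have -> : (M %| n)%N = false.
  apply/negbTE/negP => Mn'; move: Mn; rewrite dvdn_addr// => /(dvdn_leq (ltn0Sn j)).
  by rewrite leqNgt jM.
rewrite andbF mul0e add0e subr0 mul1e.
have -> : (fun x => value (t + j) k x n.+1 Arm2) = (fun x =>
    ((j%:R * g2 x n.+1)%:E +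
      iter j (gauss_smooth D) (fun x => value t k x (n + j.+1) Arm2) x)%E).
  by apply/funext => x; rewrite IH ?(ltnW jM) ?addSnnS.
have [mu_ u0] := iter_gauss_smooth_value t k (n + j.+1) Arm2 j.
rewrite gauss_smooth_g2D// addeA -EFinD -natr1 mulrDl mul1r.
by rewrite [g2 X n + _]addrC.
Qed.

(* The exact cost recursion over one batch; inside the batch the run lemmas
   apply because the last action is repeated. *)
Lemma value_batch t k X n a : (M %| k)%N -> (M %| n)%N ->
  value (t + M) k X n a =
  ((sigma k X n)%:E * ((M%:R * g1 X n)%:E + value t (k + M) X n Arm1) +
   (1 - sigma k X n)%:E * ((M%:R * g2 X n)%:E +
     gauss_smooth (M%:R * D) (fun x => value t k x (n + M) Arm2) X))%E.
Proof.
(* The first step of the batch makes the selection; the other [j] steps are forced. *)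
move=> Mk Mn; have [j Mj] : exists j, M = j.+1 by exists M.-1; rewrite prednK.
have jM : (j < M)%N by rewrite Mj.
have kj : (k.+1 + j = k + M)%N by rewrite Mj addSnnS.
have nj : (n.+1 + j = n + M)%N by rewrite Mj addSnnS.
have -> : (t + M = (t + j).+1)%N by rewrite Mj addnS.
rewrite value_step /select_prob Mk Mn [_ && _]/=.
rewrite (value_run1 t (k := k.+1) X n jM); last by rewrite kj dvdn_add.
rewrite kj.
have -> : (fun x => value (t + j) k x n.+1 Arm2) = (fun x =>
    ((j%:R * g2 x n.+1)%:E +
      iter j (gauss_smooth D) (fun x => value t k x (n + M) Arm2) x)%E).
  by apply/funext => x; rewrite (value_run2 t k x jM) nj// dvdn_add.
have [mu_ u0] := iter_gauss_smooth_value t k (n + M) Arm2 j.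
rewrite (gauss_smooth_g2D X n _ mu_ u0)//.
rewrite [((g1 X n)%:E + _)%E]addeA [((g2 X n)%:E + _)%E]addeA -!EFinD.
have -> : g1 X n + j%:R * g1 X n = M%:R * g1 X n.
  by rewrite Mj -natr1 mulrDl mul1r addrC.
have -> : g2 X n + j%:R * g2 X n = M%:R * g2 X n.
  by rewrite Mj -natr1 mulrDl mul1r addrC.
have iterE : iter j.+1 (gauss_smooth D) (fun x => value t k x (n + M) Arm2) X =
    gauss_smooth (M%:R * D) (fun x => value t k x (n + M) Arm2) X.
  have -> : M%:R * D = j.+1%:R * D by rewrite Mj.
  apply: (iter_gauss_smooth j X D0); first exact: measurable_value.
  by move=> x; exact: value_ge0.
by rewrite -iterE.
Qed.

Lemma value_fin_num t k X n a : value t k X n a \is a fin_num.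
Proof.
rewrite ge0_fin_numE; last exact: value_ge0.
apply: (@le_lt_trans _ _ (t%:R * C * expR (D^-1 * (`|X| * C)))%:E).
  apply: post_bounded.
  - exact: measurable_regret.
  - by move=> m x; exact: regret_ge0.
  - by rewrite mulr_ge0// ltW.
  - by move=> m mC; rewrite (le_trans (regret_le _ _ _ _ _ _ _ _ _))// ler_wpM2l.
by rewrite ltry.
Qed.

(** On the empty history the exponential weight is one, so posterior integration is integration
    against the prior, and the loss is the full regret. *)
Lemma integrated_lossE (N : nat) (nu : probability R R) :
  nu.-integrable [set: R] (fun x => x%:E) -> \int[nu]_x x = 0 ->
  (integrated_loss N M C D nu lam sigma)%:E = value N 0 0 0 Arm2.
Proof.
move=> inu nu0; rewrite -[RHS]fineK; last exact: value_fin_num.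
congr (fine _)%:E; rewrite [LHS]integral_mkcond; apply: eq_integral => m _.
rewrite restrict_EFin /= patchE /loss (expect_total_income M D0 sigma m N [::] inu nu0).
rewrite /weight /prior patchE /total_income /income2 !big_nil /=.
rewrite add0r opprB addrC subrK mul0r mulr0 mul0r subrr mulr0 expR0 mulr1.
by case: ifP => _; rewrite ?mul0r// mulrC.
Qed.

End Value.

(** * The risk recursions and the optimal rule *)

Section Risk.
Context (M : nat) (M0 : (0 < M)%N).
Local Notation fMD := (gauss_pdf (M%:R * D) 0).
(* [convex.conv] of MathComp-Analysis shadows the convolution. *)
Local Notation conv := Defs.conv.

Let MD0 : 0 < M%:R * D. Proof. by rewrite mulr_gt0// ltr0n. Qed.

(* Both risk recursions in terms of the number [b] of remaining batches only;
   neither the horizon nor [k] matters otherwise. *)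
Fixpoint batch_risk (b : nat) (X : R) (n : nat) : R :=
  if b is b'.+1 then
    Num.min ((b * M)%:R * g1 X n)
            (M%:R * g2 X n + conv (fun x => batch_risk b' x (n + M)) fMD X)
  else 0.

Lemma batch_riskS b X n : batch_risk b.+1 X n =
  Num.min ((b.+1 * M)%:R * g1 X n)
          (M%:R * g2 X n + conv (fun x => batch_risk b x (n + M)) fMD X).
Proof. by []. Qed.

Lemma conv_fine (u : R -> R) X : measurable_fun setT u -> (forall x, 0 <= u x) ->
  conv u fMD X = fine (gauss_smooth (M%:R * D) (EFin \o u) X).
Proof. by move=> mu_ u0; rewrite -integral_conv. Qed.

Lemma measurable_conv (u : R -> R) : measurable_fun setT u ->
  (forall x, 0 <= u x) -> measurable_fun setT (conv u fMD).
Proof.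
move=> mu_ u0; have -> : conv u fMD = fine \o gauss_smooth (M%:R * D) (EFin \o u).
  by apply/funext => X; rewrite conv_fine.
apply: measurableT_comp => //; apply: measurable_gauss_smooth => //.
exact/measurable_EFinP.
Qed.

Lemma batch_risk_props b n :
  measurable_fun setT (fun X => batch_risk b X n) /\
  (forall X, 0 <= batch_risk b X n).
Proof.
elim: b n => [|b IH] n /=; first by split=> // X; rewrite lexx.
have [mb b0] := IH (n + M)%N.
split=> [|X].
  apply: measurable_minr; first exact: measurable_funM (measurable_g1 n).
  apply: measurable_funD; first exact: measurable_funM (measurable_g2 n).
  exact: measurable_conv.
rewrite le_min mulr_ge0 ?g1_ge0//= addr_ge0 ?mulr_ge0 ?g2_ge0//.
apply: Rintegral_ge0 => x _; rewrite mulr_ge0 ?gauss_pdf_ge0//; exact: b0.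
Qed.

Lemma batch_risk_ge0 b X n : 0 <= batch_risk b X n.
Proof. by have [] := batch_risk_props b n. Qed.

Lemma measurable_batch_risk b n : measurable_fun setT (fun X => batch_risk b X n).
Proof. by have [] := batch_risk_props b n. Qed.

Lemma measurable_EFin_batch_risk b n :
  measurable_fun setT (fun X => (batch_risk b X n)%:E).
Proof. by apply/measurable_EFinP; exact: measurable_batch_risk. Qed.

Lemma batch_risk_le b X n : batch_risk b X n <= (b * M)%:R * g1 X n.
Proof. by case: b => [|b] /=; [rewrite mul0r|rewrite ge_min lexx]. Qed.

Lemma measurable_EFin_g1 n : measurable_fun setT (fun X => (g1 X n)%:E).
Proof. by apply/measurable_EFinP; exact: measurable_g1. Qed.

Lemma EFin_g1_ge0 n x : (0 <= (g1 x n)%:E)%E.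
Proof. by rewrite lee_fin g1_ge0. Qed.

(** The one-step identity is iterated [M] times, and the [M] smoothings compose to a single one of
    variance [M%:R * D]. *)
Lemma gauss_smooth_batch_g1 X n :
  gauss_smooth (M%:R * D) (fun x => (g1 x (n + M))%:E) X = (g1 X n)%:E.
Proof.
have iterE j : iter j (gauss_smooth D) (fun x => (g1 x (n + j))%:E) X = (g1 X n)%:E.
  elim: j X n => [|j IH] X n; first by rewrite addn0.
  rewrite iterS -[RHS]gauss_smooth_g1; apply: (congr1 (gauss_smooth D ^~ X)).
  by apply/funext => x; rewrite -[RHS](IH x n.+1) addSnnS.
have [j Mj] : exists j, M = j.+1 by exists M.-1; rewrite prednK.
have -> : M%:R * D = j.+1%:R * D by rewrite Mj.
rewrite -(iter_gauss_smooth j X D0); last 2 first.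
- exact: measurable_EFin_g1.
- by move=> x; exact: EFin_g1_ge0.
by rewrite -[in RHS](iterE j.+1) -Mj.
Qed.

(** The smoothing is finite because the risk is at most a multiple of [g1], whose smoothing is again
    [g1]. *)
Lemma EFin_conv_batch_risk b X n :
  (conv (fun x => batch_risk b x (n + M)) fMD X)%:E =
  gauss_smooth (M%:R * D) (fun x => (batch_risk b x (n + M))%:E) X.
Proof.
rewrite conv_fine; last 2 first.
- exact: measurable_batch_risk.
- by move=> x; exact: batch_risk_ge0.
rewrite fineK// ge0_fin_numE; last first.
  by apply: gauss_smooth_ge0 => x; rewrite lee_fin batch_risk_ge0.
apply: (@le_lt_trans _ _ (gauss_smooth (M%:R * D)
    (fun x => (b * M)%:R%:E * (g1 x (n + M))%:E)%E X)).
  apply: le_gauss_smooth.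
  - exact: measurable_EFin_batch_risk.
  - by apply: emeasurable_funM => //; exact: measurable_EFin_g1.
  - by move=> x; rewrite lee_fin batch_risk_ge0.
  - by move=> x; rewrite -EFinM lee_fin batch_risk_le.
rewrite (gauss_smoothZ _ _ (measurable_EFin_g1 _) (EFin_g1_ge0 _))//.
by rewrite gauss_smooth_batch_g1 -EFinM ltry.
Qed.

(* Applying the first arm during one batch is always admissible and does not
   change the statistics, so one more batch costs at most [M * g1]. *)
Lemma batch_risk_succ_le b X n :
  batch_risk b.+1 X n <= M%:R * g1 X n + batch_risk b X n.
Proof.
elim: b X n => [|b IH] X n.
  by rewrite [leRHS]addr0 (le_trans (batch_risk_le _ _ _))// mul1n.
have mMg : measurable_fun setT (fun x => (M%:R%:E * (g1 x (n + M))%:E)%E).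
  by apply: emeasurable_funM => //; exact: measurable_EFin_g1.
have Mg0 x : (0 <= M%:R%:E * (g1 x (n + M))%:E)%E.
  by rewrite mule_ge0// EFin_g1_ge0.
have gE : gauss_smooth (M%:R * D) (fun x => M%:R%:E * (g1 x (n + M))%:E)%E X =
    (M%:R * g1 X n)%:E.
  rewrite (gauss_smoothZ _ _ (measurable_EFin_g1 _) (EFin_g1_ge0 _))//.
  by rewrite gauss_smooth_batch_g1 EFinM.
(* The induction hypothesis is smoothed; the extra [M%:R * g1] at [n + M] returns as [M%:R * g1] at
   [n], which is what allows the postponement. *)
have convS : conv (fun x => batch_risk b.+1 x (n + M)) fMD X <=
    M%:R * g1 X n + conv (fun x => batch_risk b x (n + M)) fMD X.
  rewrite -lee_fin EFinD (EFin_conv_batch_risk b.+1) (EFin_conv_batch_risk b) -gE.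
  rewrite -gauss_smoothD//; last 2 first.
  - exact: measurable_EFin_batch_risk.
  - by move=> x; rewrite lee_fin batch_risk_ge0.
  apply: le_gauss_smooth.
  - exact: measurable_EFin_batch_risk.
  - by apply: emeasurable_funD => //; exact: measurable_EFin_batch_risk.
  - by move=> x; rewrite lee_fin batch_risk_ge0.
  - by move=> x; rewrite -EFinM -EFinD lee_fin IH.
(* Each branch on the right dominates the same branch on the left: one more batch of the first arm
   at once, or after the batch of the second. *)
rewrite [in leRHS]batch_riskS addr_minr le_min; apply/andP; split.
  by rewrite (le_trans (batch_risk_le _ _ _))// [(b.+2 * M)%N]mulSn natrD mulrDl.
by rewrite [in leLHS]batch_riskS ge_min addrCA lerD2l convS orbT.
Qed.

(** A single batch of the first arm followed by optimal play costs no more than the first arm to the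
    end, and by [batch_risk_succ_le] it does not beat the best rule that never returns from the
    first arm. *)
Lemma full_risk_recE b k X n :
  full_risk_rec M C D lam b k X n = batch_risk b X n.
Proof.
elim: b k X n => [//|b IH] k X n; rewrite [LHS]/= IH.
under [X in conv X]eq_fun do rewrite IH.
apply/eqP; rewrite eq_le; apply/andP; split.
  rewrite batch_riskS le_min !ge_min lexx orbT andbT.
  by rewrite mulSn natrD mulrDl lerD2l batch_risk_le.
by rewrite le_min batch_risk_succ_le batch_riskS ge_min lexx orbT.
Qed.

(** The hypothesis identifies the coefficient [N - n] with [b * M] and persists when [n] grows by
    [M]. *)
Lemma risk_recE N b X n : N = (n + b * M)%N ->
  risk_rec N M C D lam b X n = batch_risk b X n.
Proof.
elim: b X n => [//|b IH] X n NE /=.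
under [X in conv X]eq_fun do rewrite IH ?NE ?mulSn ?addnA//.
by rewrite NE addKn.
Qed.

Lemma riskE N b X n : N = (n + b * M)%N -> risk N M C D lam X n = batch_risk b X n.
Proof. by move=> NE; rewrite /risk {2}NE addKn mulnK// risk_recE. Qed.

(** By [value_batch] the cost is a convex combination of two branches, each at least
    [batch_risk b.+1]; for the first arm this is [batch_risk_succ_le]. *)
Lemma batch_risk_le_value (sigma : strategy R) b k X n a :
  (M %| k)%N -> (M %| n)%N ->
  ((batch_risk b X n)%:E <= value M sigma (b * M) k X n a)%E.
Proof.
elim: b k X n a => [|b IH] k X n a Mk Mn; first exact: value_ge0.
have /andP[p0 p1] := select1_prob sigma k X n.
rewrite mulSn addnC value_batch//; set p := sigma k X n in p0 p1 *.
have -> : batch_risk b.+1 X n = p * batch_risk b.+1 X n + (1 - p) * batch_risk b.+1 X n.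
  by ring.
rewrite EFinD !EFinM; apply: leeD; apply: lee_wpmul2l; rewrite ?lee_fin ?subr_ge0//.
  apply: (@le_trans _ _ (M%:R * g1 X n + batch_risk b X n)%:E).
    by rewrite lee_fin batch_risk_succ_le.
  by rewrite EFinD leeD2l// IH// dvdn_add.
apply: (@le_trans _ _ (M%:R * g2 X n +
    conv (fun x => batch_risk b x (n + M)) fMD X)%:E).
  by rewrite lee_fin /= ge_min lexx orbT.
rewrite EFinD EFin_conv_batch_risk leeD2l//; apply: le_gauss_smooth.
- exact: measurable_EFin_batch_risk.
- exact: measurable_value.
- by move=> x; rewrite lee_fin batch_risk_ge0.
- by move=> x; rewrite IH// dvdn_add.
Qed.

Lemma measurable_risk1 N n :
  measurable_fun setT (fun X => risk1 N C D lam X n).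
Proof.
rewrite /risk1; case: (n < N)%N => //.
exact: measurable_funM (measurable_g1 n).
Qed.

Lemma risk2E N b X n : N = (n + b.+1 * M)%N ->
  risk2 N M C D lam X n =
  M%:R * g2 X n + conv (fun x => batch_risk b x (n + M)) fMD X.
Proof.
move=> NE; rewrite /risk2 ifT; last by rewrite NE -[ltnLHS]addn0 ltn_add2l muln_gt0.
have -> // : (fun x => risk N M C D lam x (n + M)) =
             (fun x => batch_risk b x (n + M)).
by apply/funext => x; apply: riskE; rewrite NE mulSn addnA.
Qed.

Section OneArmedRule.
Context (N : nat) (sigma : strategy R).
Hypothesis rule : one_armed_rule N M C D lam sigma.

(** After a batch of the first arm the rule never leaves it; [X] and [n] are frozen and every
    further batch costs [M%:R * g1 X n]. *)
Lemma value_stay b k X n a : (0 < k)%N -> (M %| k)%N -> (M %| n)%N ->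
  (k + n + b * M = N)%N -> (n = 0%N -> X = 0) ->
  value M sigma (b * M) k X n a = ((b * M)%:R * g1 X n)%:E.
Proof.
elim: b k a => [|b IH] k a k0 Mk Mn NE X0.
  by rewrite mul0n mul0r /value /post; under eq_integral do rewrite mulr0;
     rewrite integral0.
rewrite mulSn addnC value_batch// (rule.2 k)//; last first.
  by rewrite -NE -[ltnLHS]addn0 ltn_add2l muln_gt0.
rewrite subrr mul0e adde0 mul1e IH//.
- by rewrite -EFinD natrD mulrDl addrC.
- by rewrite addn_gt0 k0.
- by rewrite dvdn_add.
- by rewrite -NE mulSn addnA (addnAC k).
Qed.

Lemma value_rule b X n a : (M %| n)%N -> (n + b * M = N)%N ->
  (n = 0%N -> X = 0) -> value M sigma (b * M) 0 X n a = (batch_risk b X n)%:E.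
Proof.
elim: b X n a => [|b IH] X n a Mn NE X0.
  by rewrite mul0n /value /post; under eq_integral do rewrite mulr0;
     rewrite integral0.
have nN : (n < N)%N by rewrite -NE -[ltnLHS]addn0 ltn_add2l muln_gt0.
have NM : ((n + M) + b * M = N)%N by rewrite -NE mulSn addnA.
rewrite mulSn addnC value_batch// add0n.
rewrite (value_stay (k := M))//; last by rewrite -NE mulSn addnCA addnA.
have -> : (fun x => value M sigma (b * M) 0 x (n + M) Arm2) =
          (fun x => (batch_risk b x (n + M))%:E).
  apply/funext => x; apply: IH => //; first by rewrite dvdn_add.
  (* After a batch of the second arm the count is positive, so every real [x] is an admissible
     statistic. *)
  by move/eqP; rewrite addn_eq0 [M == 0%N]gtn_eqF// andbF.
rewrite -EFin_conv_batch_risk; set p := sigma 0%N X n.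
transitivity (p * (M%:R * g1 X n + (b * M)%:R * g1 X n) + (1 - p) *
  (M%:R * g2 X n + conv (fun x => batch_risk b x (n + M)) fMD X))%:E; first by [].
congr (_%:E).
have := rule.1 X n Mn nN X0; rewrite (@risk2E N b)// /risk1 nN -/p.
have -> : (N - n = b.+1 * M)%N by rewrite -NE addKn.
have -> : M%:R * g1 X n + (b * M)%:R * g1 X n = (b.+1 * M)%:R * g1 X n.
  by rewrite mulSn natrD mulrDl.
rewrite batch_riskS; set r1 := _ * g1 X n; set r2 := _ + conv _ _ _.
(* In a tie the convex combination equals the common value for any selection probability. *)
move=> [lt12 lt21]; case: (ltgtP r1 r2) => [/lt12 ->|/lt21 ->|->].
- by rewrite mul1r subrr mul0r addr0.
- by rewrite mul0r subr0 mul1r add0r.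
- by ring.
Qed.

End OneArmedRule.

Lemma exists_one_armed_rule N : (M %| N)%N ->
  exists sigma : strategy R, one_armed_rule N M C D lam sigma.
Proof.
move=> MN.
(* Ties go to the second arm. The guard on [n] gives access to [risk2E], from which measurability in
   [X] follows. *)
pose s k X n : R := if (0 < k)%N then 1 else if (M %| n)%N && (n < N)%N then
  if risk1 N C D lam X n < risk2 N M C D lam X n then 1 else 0 else 0.
have s01 k X n : 0 <= s k X n <= 1.
  rewrite /s; case: (0 < k)%N; first by rewrite ler01 lexx.
  case: ((M %| n)%N && (n < N)%N); last by rewrite lexx ler01.
  by case: ifP => _; rewrite lexx ler01.
have ms k n : measurable_fun setT (fun X => s k X n).
  rewrite /s; case: (0 < k)%N => //.
  case: (boolP ((M %| n)%N && (n < N)%N)) => // /andP[Mn nN].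
  have [b NE] : exists b, N = (n + b.+1 * M)%N.
    exists ((N - n) %/ M).-1; rewrite prednK ?divn_gt0//.
      by rewrite divnK ?dvdn_sub// subnKC// ltnW.
    by rewrite dvdn_leq ?subn_gt0// dvdn_sub.
  have m2 : measurable_fun setT (fun X => risk2 N M C D lam X n).
    under eq_fun do rewrite (risk2E _ NE).
    apply: measurable_funD; first exact: measurable_funM (measurable_g2 n).
    apply: measurable_conv; first exact: measurable_batch_risk.
    by move=> x; exact: batch_risk_ge0.
  have mlt := measurable_fun_ltr (measurable_risk1 N n) m2.
  have := measurable_fun_ifT mlt (measurable_cst (1 : R)) (measurable_cst (0 : R)).
  exact.
exists (Strategy s01 ms); split => [X n Mn nN _|k X n k0 _ _ _ _] /=.
  by rewrite /s ltnn Mn nN /=; split=> [->//|/ltW]; rewrite leNgt => /negbTE ->.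
by rewrite /s k0.
Qed.

End Risk.
End Prior.

Theorem theorem2p4 (R : realType) (N M : nat) (C D : R)
    (nu : probability R R) (lam : R -> R)
    (hN : (0 < N)%N) (hM : (0 < M)%N) (hMN : (M %| N)%N)
    (hC : 0 < C) (hD : 0 < D)
    (nu_int : nu.-integrable [set: R] (fun x => x%:E))
    (nu_mean : \int[nu]_x x = 0)
    (lam_meas : measurable_fun `[- C, C] lam)
    (lam_ge0 : forall m : R, - C <= m <= C -> 0 <= lam m)
    (lam_mass : (\int[lebesgue_measure]_(m in `[(- C)%R, C]) (lam m)%:E = 1)%E)
    (lam_neg : 0 < \int[lebesgue_measure]_(m in `[- C, 0]) (`|m| * lam m))
    (lam_pos : 0 < \int[lebesgue_measure]_(m in `[0, C]) (m * lam m)) :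
  (forall (X : R) (n : nat), (M %| n)%N -> (n <= N)%N ->
     risk N M C D lam X n = full_risk N M C D lam 0 X n) /\
  bayes_risk N M C D nu lam = risk N M C D lam 0 0 /\
  (exists sigma : strategy R, one_armed_rule N M C D lam sigma) /\
  (forall sigma : strategy R, one_armed_rule N M C D lam sigma ->
     bayesian N M C D nu lam sigma).
Proof.
set B := (N %/ M)%N.
have BM : (B * M = N)%N by rewrite divnK.
have lossE sigma : (integrated_loss N M C D nu lam sigma)%:E =
    value C D lam M sigma (B * M) 0 0 0 Arm2.
  rewrite BM; exact: (integrated_lossE hD hC lam_meas lam_ge0 lam_mass).
have loss_ge sigma :
    batch_risk C D lam M B 0 0 <= integrated_loss N M C D nu lam sigma.
  rewrite -lee_fin lossE.
  exact: (batch_risk_le_value hD hC lam_meas lam_ge0 lam_mass hM sigma B 0 Arm2).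
have loss_rule sigma : one_armed_rule N M C D lam sigma ->
    integrated_loss N M C D nu lam sigma = batch_risk C D lam M B 0 0.
  move=> rule; apply: EFin_inj; rewrite lossE.
  exact: (value_rule hD hC lam_meas lam_ge0 lam_mass hM rule).
have [sigma0 rule0] :=
  exists_one_armed_rule hD hC lam_meas lam_ge0 lam_mass hM hMN.
split; [|split; [|split]].
- move=> X n Mn nN.
  have NE : N = (n + (N - n) %/ M * M)%N by rewrite divnK ?dvdn_sub// subnKC.
  rewrite (riskE C D lam hM X NE) /full_risk add0n.
  by rewrite (full_risk_recE hD hC lam_meas lam_ge0 lam_mass hM).
- have NE : N = (0 + B * M)%N by rewrite BM.
  (* The infimum is attained at [sigma0]; [ge_inf] also asks for a lower bound of the range,
     supplied by [loss_ge]. *)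
  rewrite (riskE C D lam hM 0 NE); apply/le_anti/andP; split.
    rewrite -(loss_rule _ rule0); apply: ge_inf; last by exists sigma0.
    by exists (batch_risk C D lam M B 0 0) => _ [sigma _ <-].
  apply: lb_le_inf; first by exists (integrated_loss N M C D nu lam sigma0), sigma0.
  by move=> _ [sigma _ <-].
- by exists sigma0.
- by move=> sigma rule tau; rewrite (loss_rule _ rule).
Qed.
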